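(* Let $A\in\mathbb R^{n\times n}$, $B\in\mathbb R^{n\times m}$, $C\in\mathbb R^{p\times n}$, $G=BB^{T}$, $Q=C^{T}C$, and let $X,Y\in\mathbb R^{n\times n}$ be symmetric positive semi-definite solutions of $$A^{T}X+XA+Q-XGX=0\qquad\text{and}\qquad AY+YA^{T}-YQY+G=0,$$ respectively. Put $R=A-GX$, $S=A^{T}-QY$, and let $\alpha>0$ be such that $A-\alpha I$, $R-\alpha I$ and $S-\alpha I$ are nonsingular. Let $\{\widehat A_k\},\{X_k\},\{Y_k\}$, $k=0,1,2,\dots$, be the sequences generated by the ADDA iteration with parameter $\alpha$ (defined in the context), and let $\mathscr C(R;\alpha)$, $\mathscr C(S;\alpha)$ be the Cayley transforms defined in the context. If $\rho(\mathscr C(R;\alpha))<1$, then for every $k$ the following bounds hold, and their right-hand sides tend to $0$ as $k\to\infty$: (a) $\|\widehat A_k\|_2\le(1+\|Y\|_2\|X\|_2)\,\|[\mathscr C(R;\alpha)]^{2^k}\|_2\to 0$ $(k\to\infty)$; (b) $\|X-X_k\|_2\le(\|X\|_2+\|X\|_2^2\|Y\|_2)\,\|[\mathscr C(S;\alpha)]^{2^k}\|_2\,\|[\mathscr C(R;\alpha)]^{2^k}\|_2\to 0$ $(k\to\infty)$; (c) $\|Y-Y_k\|_2\le(\|Y\|_2+\|Y\|_2^2\|X\|_2)\,\|[\mathscr C(R;\alpha)]^{2^k}\|_2\,\|[\mathscr C(S;\alpha)]^{2^k}\|_2\to 0$ $(k\to\infty)$.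
   Context: $\rho(\cdot)$ is the spectral radius (maximum modulus of the complex eigenvalues) and $\|\cdot\|_2$ the matrix 2-norm (spectral norm). Cayley transform: for a square matrix $T$ with $T-\alpha I$ nonsingular, $\mathscr C(T;\alpha)=(T+\alpha I)(T-\alpha I)^{-1}=(T-\alpha I)^{-1}(T+\alpha I)$. ADDA (alternating direction doubling algorithm) iteration with parameter $\alpha$: set $$A_\alpha=A-\alpha I,\qquad U_\alpha=A_\alpha^{T}+QA_\alpha^{-1}G,\qquad V_\alpha=A_\alpha+GA_\alpha^{-T}Q$$ (where $A_\alpha^{-T}=(A_\alpha^{-1})^{T}$). The initial matrices are $$\widehat A_0=I+2\alpha V_\alpha^{-1},\qquad X_0=2\alpha U_\alpha^{-1}QA_\alpha^{-1},\qquad Y_0=2\alpha A_\alpha^{-1}GU_\alpha^{-1},$$ and for $k=0,1,2,\dots$ $$\widehat A_{k+1}=\widehat A_k(I_n+Y_kX_k)^{-1}\widehat A_k,$$ $$X_{k+1}=X_k+\widehat A_k^{T}(I_n+X_kY_k)^{-1}X_k\widehat A_k,$$ $$Y_{k+1}=Y_k+\widehat A_kY_k(I_n+X_kY_k)^{-1}\widehat A_k^{T}.$$ *)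

(* Defs.v *)
From HB Require Import structures.
From mathcomp Require Import all_boot all_order all_algebra.
From mathcomp Require Import complex.
From mathcomp Require Import all_classical all_reals all_analysis.

Set Implicit Arguments.
Unset Strict Implicit.
Unset Printing Implicit Defensive.

Import Order.TTheory GRing.Theory Num.Theory.
Import numFieldNormedType.Exports.

Local Open Scope classical_set_scope.
Local Open Scope ring_scope.

Definition vnorm2 (K : realType) (n : nat) (x : 'cV[K]_n) : K :=
  Num.sqrt (\sum_(i < n) x i 0 ^+ 2).

(* The set is bounded; it is empty only for [n = 0], where [sup set0 = 0]. *)
Definition mxnorm2 (K : realType) (m n : nat) (M : 'M[K]_(m, n)) : K :=
  sup [set vnorm2 (M *m x) | x in [set x : 'cV[K]_n | vnorm2 x = 1]].

(* The eigenvalues are those of [M] over [K[i]]: a finite set, empty only for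
   [n = 0], so that the supremum is a maximum. *)
Definition spectral_radius (K : realType) (n : nat) (M : 'M[K]_n) : K :=
  sup [set ComplexField.Normc.normc l | l in
        [set l : K[i]%C | eigenvalue (map_mx (real_complex K) M) l]].

Definition sym_psd (K : realType) (n : nat) (M : 'M[K]_n) : Prop :=
  M^T = M /\ forall v : 'cV[K]_n, 0 <= (v^T *m M *m v) 0 0.

Definition cayley (K : realType) (n : nat) (T : 'M[K]_n) (alpha : K) : 'M[K]_n :=
  (T + alpha%:M) *m invmx (T - alpha%:M).

Record adda_state (K : realType) (n : nat) : Type := AddaState {
  adda_A : 'M[K]_n;
  adda_X : 'M[K]_n;
  adda_Y : 'M[K]_n }.

Definition adda_init (K : realType) (n : nat) (A G Q : 'M[K]_n) (alpha : K) :
    adda_state K n :=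
  let Aa := A - alpha%:M in
  let Ua := Aa^T + Q *m invmx Aa *m G in
  let Va := Aa + G *m (invmx Aa)^T *m Q in
  {| adda_A := 1%:M + (2 * alpha) *: invmx Va;
     adda_X := (2 * alpha) *: (invmx Ua *m Q *m invmx Aa);
     adda_Y := (2 * alpha) *: (invmx Aa *m G *m invmx Ua) |}.

Definition adda_step (K : realType) (n : nat) (s : adda_state K n) :
    adda_state K n :=
  let: AddaState Ah X Y := s in
  {| adda_A := Ah *m invmx (1%:M + Y *m X) *m Ah;
     adda_X := X + Ah^T *m invmx (1%:M + X *m Y) *m X *m Ah;
     adda_Y := Y + Ah *m Y *m invmx (1%:M + X *m Y) *m Ah^T |}.

(* [invmx] is total, but all the matrices inverted here are nonsingular as soon
   as [A - alpha%:M] is, when [G] and [Q] are symmetric positive semi-definite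
   and [0 < alpha]. *)
Definition adda (K : realType) (n : nat) (A G Q : 'M[K]_n) (alpha : K)
    (k : nat) : adda_state K n :=
  iter k (@adda_step K n) (adda_init A G Q alpha).

(* Main.v *)
Require Import Defs.
From HB Require Import structures.
From mathcomp Require Import all_boot all_order all_algebra.
From mathcomp Require Import complex.
From mathcomp Require Import all_classical all_reals all_analysis.
From mathcomp Require Import ring lra.

Set Implicit Arguments.
Unset Strict Implicit.
Unset Printing Implicit Defensive.

Import Order.TTheory GRing.Theory Num.Theory.
Import numFieldNormedType.Exports.

Local Open Scope classical_set_scope.
Local Open Scope ring_scope.

(* With the Hamiltonian [H = [[A, -G], [-Q, -A^T]]], one has [H [I; X] = [I;
   X] R] and [H [-Y; I] = - [-Y; I] S]. The Cayley transform of [H] is encoded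
   by the initial iterates, and each doubling step squares it, so that [Ah_k =
   (I + Y_k X) C(R)^(2^k)] and [X - X_k = Ah_k^T X C(R)^(2^k)], with the
   transposed relations [Ah_k^T = (I + X_k Y) C(S)^(2^k)] and [Y - Y_k = Ah_k Y
   C(S)^(2^k)]. The first two give [X - X_k = C(R)^(2^k)^T (X + X Y_k X)
   C(R)^(2^k) >= 0], hence [0 <= X_k <= X], and likewise [0 <= Y_k <= Y]; the
   norm bounds follow. For the limits, [(I + X Y) S = R^T (I + X Y)], so the
   powers of [C(S)] and of [C(R)^T] are similar. *)

(** * Spectral norm and positive semi-definite matrices *)

Lemma discriminant_le (K : realType) (a b c : K) :
  0 <= c -> (forall t, 0 <= a + 2 * b * t + c * t ^+ 2) -> b ^+ 2 <= a * c.
Proof.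
move=> c0 H; have [c_gt0|] := ltP 0 c; last first.
  move=> c_le0; have c_eq0 : c = 0 by apply/le_anti/andP.
  rewrite c_eq0 mulr0.
  have [->|b0] := eqVneq b 0; first by rewrite expr0n.
  (* With [c = 0] the polynomial is affine in [t]; this point is where it takes the value -1. *)
  have := H (- (a + 1) / (2 * b)); rewrite c_eq0 mul0r addr0 => {}H.
  suff : 2 * b * (- (a + 1) / (2 * b)) = - (a + 1) by move=> E; rewrite E in H; lra.
  by field.
(* The minimiser of the quadratic. *)
have := H (- b / c).
have -> : a + 2 * b * (- b / c) + c * (- b / c) ^+ 2 = (a * c - b ^+ 2) / c.
  by field; rewrite gt_eqF.
by rewrite pmulr_lge0 ?invr_gt0// subr_ge0.
Qed.

(** At [M = 1%:M] this is the Euclidean inner product, so a single Cauchy-Schwarz inequality serves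
    both for [vnorm2] and for semi-definite forms. *)
Definition mxform (K : realType) (n : nat) (M : 'M[K]_n) (u v : 'cV[K]_n) : K :=
  (u^T *m M *m v) 0 0.

Lemma mxformDl (K : realType) n (M : 'M[K]_n) u v w :
  mxform M (u + v) w = mxform M u w + mxform M v w.
Proof. by rewrite /mxform [(u + v)^T]linearD/= !mulmxDl mxE. Qed.

Lemma mxformDr (K : realType) n (M : 'M[K]_n) u v w :
  mxform M w (u + v) = mxform M w u + mxform M w v.
Proof. by rewrite /mxform mulmxDr mxE. Qed.

Lemma mxformZl (K : realType) n (M : 'M[K]_n) t u v :
  mxform M (t *: u) v = t * mxform M u v.
Proof. by rewrite /mxform [(t *: u)^T]linearZ/= -!scalemxAl mxE. Qed.

Lemma mxformZr (K : realType) n (M : 'M[K]_n) t u v :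
  mxform M u (t *: v) = t * mxform M u v.
Proof. by rewrite /mxform -scalemxAr mxE. Qed.

Lemma mxformC (K : realType) n (M : 'M[K]_n) u v :
  M^T = M -> mxform M u v = mxform M v u.
Proof.
move=> sM; rewrite /mxform.
have -> : u^T *m M *m v = (v^T *m M *m u)^T.
  by rewrite !trmx_mul trmxK sM mulmxA.
by rewrite mxE.
Qed.

(** The form at [u + t *: v] is a nonnegative quadratic in [t]; the inequality is its discriminant
    condition. Its leading coefficient may vanish, since [M] is only semi-definite. *)
Lemma psd_cauchy_schwarz (K : realType) n (M : 'M[K]_n) u v :
  sym_psd M -> mxform M u v ^+ 2 <= mxform M u u * mxform M v v.
Proof.
move=> [sM pM]; apply: discriminant_le => [|t]; first exact: pM.
have := pM (u + t *: v); congr (0 <= _).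
transitivity (mxform M u u + t * mxform M u v + t * mxform M v u
              + t ^+ 2 * mxform M v v).
  rewrite -[LHS]/(mxform M (u + t *: v) (u + t *: v)).
  by rewrite !mxformDl !mxformDr !mxformZl !mxformZr; ring.
by rewrite (mxformC v u sM); ring.
Qed.

Lemma mxform1 (K : realType) n (u : 'cV[K]_n) :
  mxform 1%:M u u = \sum_(i < n) u i 0 ^+ 2.
Proof.
by rewrite /mxform mulmx1 mxE; apply: eq_bigr => i _; rewrite mxE expr2.
Qed.

Lemma sqr_vnorm2 (K : realType) n (u : 'cV[K]_n) :
  vnorm2 u ^+ 2 = mxform 1%:M u u.
Proof.
by rewrite mxform1 /vnorm2 sqr_sqrtr// sumr_ge0// => i _; rewrite sqr_ge0.
Qed.

Lemma vnorm2_ge0 (K : realType) n (u : 'cV[K]_n) : 0 <= vnorm2 u.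
Proof. exact: sqrtr_ge0. Qed.

Lemma sym_psd1 (K : realType) n : sym_psd (1%:M : 'M[K]_n).
Proof.
split=> [|v]; first by rewrite trmx1.
by rewrite -/(mxform 1%:M v v) -sqr_vnorm2 sqr_ge0.
Qed.

Lemma mxform1_le (K : realType) n (u v : 'cV[K]_n) :
  mxform 1%:M u v <= vnorm2 u * vnorm2 v.
Proof.
have uv0 : 0 <= vnorm2 u * vnorm2 v by rewrite mulr_ge0 ?vnorm2_ge0.
have [m0|m0] := leP 0 (mxform 1%:M u v); last exact: le_trans (ltW m0) uv0.
rewrite -(@ler_pXn2r _ 2)// exprMn !sqr_vnorm2.
exact/psd_cauchy_schwarz/sym_psd1.
Qed.

Lemma vnorm2D (K : realType) n (u v : 'cV[K]_n) :
  vnorm2 (u + v) <= vnorm2 u + vnorm2 v.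
Proof.
rewrite -(@ler_pXn2r _ 2)// ?nnegrE ?addr_ge0 ?vnorm2_ge0//.
have -> : vnorm2 (u + v) ^+ 2
    = vnorm2 u ^+ 2 + 2 * mxform 1%:M u v + vnorm2 v ^+ 2.
  by rewrite !sqr_vnorm2 !mxformDl !mxformDr (mxformC v u) ?trmx1//; ring.
by have := mxform1_le u v; rewrite sqrrD; lra.
Qed.

Lemma vnorm2Z (K : realType) n (c : K) (u : 'cV[K]_n) :
  0 <= c -> vnorm2 (c *: u) = c * vnorm2 u.
Proof.
move=> c0; rewrite /vnorm2.
under eq_bigr do rewrite mxE exprMn.
by rewrite -mulr_sumr sqrtrM ?sqr_ge0// sqrtr_sqr ger0_norm.
Qed.

Lemma vnorm2_eq0 (K : realType) n (u : 'cV[K]_n) : vnorm2 u = 0 -> u = 0.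
Proof.
move=> u0; have /eqP := sqr_vnorm2 u; rewrite u0 expr0n/= mxform1 eq_sym.
rewrite psumr_eq0 => [/allP h|i _]; last by rewrite sqr_ge0.
apply/matrixP => i j; rewrite ord1 mxE; apply/eqP.
by have := h i; rewrite mem_index_enum sqrf_eq0 => /(_ isT).
Qed.

Lemma vnorm2_0 (K : realType) n : vnorm2 (0 : 'cV[K]_n) = 0.
Proof. by rewrite /vnorm2 big1 ?sqrtr0// => i _; rewrite mxE expr0n. Qed.

Lemma coord_le_vnorm2 (K : realType) n (u : 'cV[K]_n) i : `|u i 0| <= vnorm2 u.
Proof.
rewrite -sqrtr_sqr /vnorm2 ler_wsqrtr// (bigD1 i)//= lerDl sumr_ge0// => j _.
exact: sqr_ge0.
Qed.

Lemma vnorm2_le_sum (K : realType) n (u : 'cV[K]_n) :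
  vnorm2 u <= \sum_(i < n) `|u i 0|.
Proof.
have s0 : 0 <= \sum_(i < n) `|u i 0| by apply: sumr_ge0.
rewrite -[leRHS]ger0_norm// -sqrtr_sqr /vnorm2 ler_wsqrtr// expr2 mulr_suml.
apply: ler_sum => i _; rewrite -real_normK ?num_real// expr2 ler_wpM2l//.
by rewrite (bigD1 i)//= lerDl sumr_ge0.
Qed.

Lemma vnorm2_mulmx_le_sum (K : realType) m n (M : 'M[K]_(m, n)) (x : 'cV[K]_n) :
  vnorm2 (M *m x) <= (\sum_(i < m) \sum_(j < n) `|M i j|) * vnorm2 x.
Proof.
apply: le_trans (vnorm2_le_sum _) _; rewrite mulr_suml ler_sum// => i _.
rewrite mxE (le_trans (ler_norm_sum _ _ _))// mulr_suml ler_sum// => j _.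
by rewrite normrM ler_wpM2l// coord_le_vnorm2.
Qed.

Lemma mxnorm2_le (K : realType) m n (M : 'M[K]_(m, n)) c :
  0 <= c -> (forall x, vnorm2 (M *m x) <= c * vnorm2 x) -> mxnorm2 M <= c.
Proof.
move=> c0 Mc; rewrite /mxnorm2; set E := [set _ | _ in _].
(* For [n = 0] no vector has norm 1 and the supremum of the empty set is 0; this is where [0 <= c]
   enters. *)
have [->|/set0P E0] := eqVneq E set0; first by rewrite sup0.
by apply: ge_sup => // _ [x /= x1 <-]; rewrite (le_trans (Mc x))// x1 mulr1.
Qed.

Lemma vnorm2_mulmx (K : realType) m n (M : 'M[K]_(m, n)) (x : 'cV[K]_n) :
  vnorm2 (M *m x) <= mxnorm2 M * vnorm2 x.
Proof.
have [x0|x0] := eqVneq (vnorm2 x) 0.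
  by rewrite x0 mulr0 (vnorm2_eq0 x0) mulmx0 vnorm2_0.
have x_gt0 : 0 < vnorm2 x by rewrite lt_neqAle eq_sym x0 vnorm2_ge0.
rewrite -ler_pdivrMr// mulrC -vnorm2Z ?invr_ge0 ?vnorm2_ge0// scalemxAr.
apply: ub_le_sup; last first.
  by exists ((vnorm2 x)^-1 *: x) => //=; rewrite vnorm2Z ?invr_ge0 ?vnorm2_ge0// mulVf.
(* The sum of the absolute values of the entries bounds the set defining [mxnorm2 M], so its
   supremum dominates each element. *)
exists (\sum_(i < m) \sum_(j < n) `|M i j|) => _ [y /= y1 <-].
by apply: le_trans (vnorm2_mulmx_le_sum _ _) _; rewrite y1 mulr1.
Qed.

Lemma mxnorm2_ge0 (K : realType) m n (M : 'M[K]_(m, n)) : 0 <= mxnorm2 M.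
Proof.
rewrite /mxnorm2; set E := [set _ | _ in _].
have [->|/set0P[r [x /= x1 xr]]] := eqVneq E set0; first by rewrite sup0.
by have := vnorm2_mulmx M x; rewrite x1 mulr1; apply/le_trans/vnorm2_ge0.
Qed.

Lemma mxnorm2M (K : realType) m n p (M : 'M[K]_(m, n)) (N : 'M[K]_(n, p)) :
  mxnorm2 (M *m N) <= mxnorm2 M * mxnorm2 N.
Proof.
apply: mxnorm2_le => [|x]; first by rewrite mulr_ge0 ?mxnorm2_ge0.
rewrite -mulmxA (le_trans (vnorm2_mulmx _ _))// -mulrA ler_wpM2l ?mxnorm2_ge0//.
exact: vnorm2_mulmx.
Qed.

Lemma mxnorm2D (K : realType) m n (M N : 'M[K]_(m, n)) :
  mxnorm2 (M + N) <= mxnorm2 M + mxnorm2 N.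
Proof.
apply: mxnorm2_le => [|x]; first by rewrite addr_ge0 ?mxnorm2_ge0.
by rewrite mulmxDl (le_trans (vnorm2D _ _))// mulrDl lerD ?vnorm2_mulmx.
Qed.

Lemma mxnorm2_1_le (K : realType) n : mxnorm2 (1%:M : 'M[K]_n) <= 1.
Proof. by apply: mxnorm2_le => // x; rewrite mul1mx mul1r. Qed.

Lemma mxnorm2_le_sum (K : realType) m n (M : 'M[K]_(m, n)) :
  mxnorm2 M <= \sum_(i < m) \sum_(j < n) `|M i j|.
Proof.
apply: mxnorm2_le => [|x]; last exact: vnorm2_mulmx_le_sum.
by apply: sumr_ge0 => i _; apply: sumr_ge0.
Qed.

(** No eigenvalues are needed: with [w = M v], Cauchy-Schwarz for the form of [M] at [w] and [v]
    gives [|w|^4 <= (w^T M w) (v^T M v)], and both factors are bounded through [N]. Taking roots and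
    cancelling one [|w|] leaves [|w| <= |N| |v|]. *)
Lemma psd_mxnorm2_le (K : realType) n (M N : 'M[K]_n) :
  sym_psd M -> sym_psd (N - M) -> mxnorm2 M <= mxnorm2 N.
Proof.
move=> psdM [_ NM0]; have [_ M0] := psdM.
have form_le v : mxform M v v <= mxnorm2 N * vnorm2 v ^+ 2.
  apply: (@le_trans _ _ (mxform N v v)).
    have := NM0 v; rewrite mulmxBr mulmxBl !mxE.
    by rewrite subr_ge0; rewrite /mxform !mxE.
  have -> : mxform N v v = mxform 1%:M v (N *m v).
    by rewrite /mxform mulmx1 mulmxA.
  apply: le_trans (mxform1_le _ _) _.
  rewrite expr2 mulrCA ler_wpM2l ?vnorm2_ge0//; exact: vnorm2_mulmx.
apply: mxnorm2_le => [|v]; first exact: mxnorm2_ge0.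
have [w0|w0] := eqVneq (vnorm2 (M *m v)) 0.
  by rewrite w0 mulr_ge0 ?mxnorm2_ge0 ?vnorm2_ge0.
have w_gt0 : 0 < vnorm2 (M *m v) by rewrite lt_neqAle eq_sym w0 vnorm2_ge0.
have wE : mxform M (M *m v) v = vnorm2 (M *m v) ^+ 2.
  by rewrite sqr_vnorm2 /mxform mulmx1 -mulmxA.
have := psd_cauchy_schwarz (M *m v) v psdM; rewrite wE => cs.
have {}cs : (vnorm2 (M *m v) ^+ 2) ^+ 2
    <= (mxnorm2 N * vnorm2 (M *m v) * vnorm2 v) ^+ 2.
  apply: le_trans cs _; set N2 := mxnorm2 N; set w := vnorm2 _; set z := vnorm2 v.
  have -> : (N2 * w * z) ^+ 2 = (N2 * w ^+ 2) * (N2 * z ^+ 2) by ring.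
  by apply: ler_pM; [exact: M0|exact: M0|exact: form_le|exact: form_le].
rewrite -(ler_pM2l w_gt0) -expr2.
rewrite -(@ler_pXn2r _ 2) ?nnegrE ?sqr_ge0 ?mulr_ge0 ?mxnorm2_ge0 ?vnorm2_ge0//.
by apply: le_trans cs _; rewrite (mulrC (mxnorm2 N)) -mulrA.
Qed.

(** * Nonsingularity and closure properties of semi-definite matrices *)

Lemma psd_form_eq0 (K : realType) n (M : 'M[K]_n) (v : 'cV[K]_n) :
  sym_psd M -> mxform M v v = 0 -> M *m v = 0.
Proof.
move=> psdM v0; apply: vnorm2_eq0; apply/eqP.
rewrite -sqrf_eq0 sqr_vnorm2 -sqrf_eq0.
have -> : mxform 1%:M (M *m v) (M *m v) = mxform M (M *m v) v.
  by rewrite /mxform mulmx1 mulmxA.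
(* Cauchy-Schwarz at [M *m v] and [v] bounds the square of [|M v|^2] by a multiple of the vanishing
   form. *)
rewrite eq_le sqr_ge0 andbT (le_trans (psd_cauchy_schwarz _ _ psdM))//.
by rewrite v0 mulr0.
Qed.

Lemma unitmx_colP (F : fieldType) n (M : 'M[F]_n) :
  (forall v : 'cV_n, M *m v = 0 -> v = 0) -> M \in unitmx.
Proof.
move=> M0; rewrite -unitmx_tr -row_free_unit; apply: inj_row_free => v vM.
by apply/trmx_inj; rewrite trmx0; apply: M0; rewrite -[M]trmxK -trmx_mul vM trmx0.
Qed.

Lemma psd_congr (K : realType) n m (M : 'M[K]_n) (N : 'M[K]_(n, m)) :
  sym_psd M -> sym_psd (N^T *m M *m N).
Proof.
move=> [sM M0]; split=> [|v]; first by rewrite !trmx_mul trmxK sM mulmxA.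
by have := M0 (N *m v); rewrite trmx_mul !mulmxA.
Qed.

Lemma psdD (K : realType) n (M N : 'M[K]_n) :
  sym_psd M -> sym_psd N -> sym_psd (M + N).
Proof.
move=> [sM M0] [sN N0]; split=> [|v]; first by rewrite [LHS]linearD/= sM sN.
by rewrite mulmxDr mulmxDl mxE addr_ge0.
Qed.

Lemma psdZ (K : realType) n (c : K) (M : 'M[K]_n) :
  0 <= c -> sym_psd M -> sym_psd (c *: M).
Proof.
move=> c0 [sM M0]; split=> [|v]; first by rewrite [LHS]linearZ/= sM.
by rewrite -scalemxAr -scalemxAl mxE mulr_ge0.
Qed.

Lemma psd_gram (K : realType) m n (M : 'M[K]_(m, n)) : sym_psd (M^T *m M).
Proof. by rewrite -[M^T]mulmx1; apply: psd_congr; exact: sym_psd1. Qed.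

Lemma trmx_1DM (R : comPzRingType) n (P T : 'M[R]_n) :
  (1%:M + P *m T)^T = 1%:M + T^T *m P^T.
Proof. by rewrite [LHS]linearD/= trmx1 trmx_mul. Qed.

Section PsdPair.
Variables (K : realType) (n : nat) (P T : 'M[K]_n).
Hypotheses (psdP : sym_psd P) (psdT : sym_psd T).

(** If [v = - T P v], then [v^T P v = - (P v)^T T (P v) <= 0], so [P v = 0] and hence [v = 0]. *)
Lemma psd_1DM_unit : 1%:M + T *m P \in unitmx.
Proof.
apply: unitmx_colP => v; rewrite mulmxDl mul1mx -mulmxA => v0.
have {}v0 : v = - (T *m (P *m v)) by apply/eqP; rewrite -addr_eq0 v0.
suff Pv0 : P *m v = 0 by rewrite v0 Pv0 mulmx0 oppr0.
apply: psd_form_eq0 => //; apply/le_anti/andP; split; last by case: psdP => _; exact.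
rewrite /mxform {2}v0 mulmxN mxE oppr_le0.
have [sP _] := psdP; have [_ /(_ (P *m v))] := psdT.
by rewrite trmx_mul sP !mulmxA.
Qed.

(** The push-through identity, obtained by inverting both sides of [(1 + P T) P = P (1 + T P)]. *)
Lemma invmx_1DM_mul : invmx (1%:M + P *m T) *m P = P *m invmx (1%:M + T *m P).
Proof.
have [[sP _] [sT _]] := (psdP, psdT).
have uTP := psd_1DM_unit.
have uPT : 1%:M + P *m T \in unitmx.
  by rewrite -unitmx_tr trmx_1DM sP sT.
apply: (can_inj (mulKmx uPT)); rewrite mulKVmx// mulmxA mulmxDl mul1mx -mulmxA.
by rewrite -{2}[P]mulmx1 -mulmxDr mulmxK.
Qed.

(** With [J = (1 + T P)^-1], the product is the congruence [J^T (P + P T P) J] of a semi-definite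
    matrix. *)
Lemma psd_invmx_1DM : sym_psd (P *m invmx (1%:M + T *m P)).
Proof.
have [[sP _] [sT _]] := (psdP, psdT).
have -> : P *m invmx (1%:M + T *m P)
    = (invmx (1%:M + T *m P))^T *m (P + P^T *m T *m P) *m invmx (1%:M + T *m P).
  congr (_ *m _); rewrite trmx_inv trmx_1DM sP sT.
  have uPT : 1%:M + P *m T \in unitmx.
    by rewrite -unitmx_tr trmx_1DM sP sT psd_1DM_unit.
  have -> : P + P *m T *m P = (1%:M + P *m T) *m P by rewrite mulmxDl mul1mx.
  by rewrite mulKmx.
by apply/psd_congr/psdD => //; exact: psd_congr.
Qed.

End PsdPair.

(** * The doubling iteration *)

(* One doubling step preserves the relation
   [[E, 0], [- P, 1]] [1; X] = [[1, T], [0, E^T]] [1; X] M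
   between the iterates (E, P, T), a solution X and a matrix M, squaring M. *)
Lemma doubling_step (K : realType) n (E P T X M : 'M[K]_n) :
  sym_psd P -> sym_psd T ->
  E = (1%:M + T *m X) *m M -> X - P = E^T *m X *m M ->
  let E' := E *m invmx (1%:M + T *m P) *m E in
  let P' := P + E^T *m invmx (1%:M + P *m T) *m P *m E in
  let T' := T + E *m T *m invmx (1%:M + P *m T) *m E^T in
  E' = (1%:M + T' *m X) *m (M *m M) /\ X - P' = E'^T *m X *m (M *m M).
Proof.
move=> psdP psdT EE XP E' P' T'.
have [[sP _] [sT _]] := (psdP, psdT).
have uTP := psd_1DM_unit psdP psdT; have uPT := psd_1DM_unit psdT psdP.
set J := invmx (1%:M + T *m P); set L := invmx (1%:M + P *m T).
have JT : J *m T = T *m L by exact: invmx_1DM_mul.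
have trJ : J^T = L by rewrite trmx_inv trmx_1DM sP sT.
have XE : X = P + E^T *m X *m M by rewrite -XP addrC subrK.
split.
  (* Substituting [X = P + E^T X M] into [1 + T X] splits off the factor [1 + T P], which [J]
     cancels. *)
  have JE : J *m E = M + J *m T *m (E^T *m X *m (M *m M)).
    have TX : 1%:M + T *m X = (1%:M + T *m P) + T *m E^T *m X *m M.
      by rewrite {1}XE mulmxDr addrA !mulmxA.
    rewrite [in LHS]EE [in LHS]TX mulmxDl mulmxDr mulKmx//.
    by rewrite !mulmxA.
  have -> : 1%:M + T' *m X = (1%:M + T *m X) + E *m (J *m T *m E^T *m X).
    by rewrite /T' mulmxDl addrA JT !mulmxA.
  by rewrite /E' -/J -mulmxA JE mulmxDr [RHS]mulmxDl
    [(1%:M + _) *m (M *m M)]mulmxA -EE !mulmxA.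
(* After multiplication by [1 + P T], the left side reduces to [(X - P) M], to which the hypothesis
   on [X - P] applies again. *)
have key : X *m M - L *m P *m E = L *m (E^T *m X *m (M *m M)).
  have PE : P *m E = P *m M + P *m T *m (X *m M).
    by rewrite EE mulmxDl mul1mx mulmxDr !mulmxA.
  apply: (can_inj (mulKmx uPT)); rewrite mulKVmx// mulmxBr -mulmxA mulKVmx//.
  rewrite PE mulmxDl mul1mx opprD addrACA subrr addr0 -mulmxBl XP.
  by rewrite !mulmxA.
rewrite /P' opprD addrA XP /E' !trmx_mul -/J trJ -!mulmxA -mulmxBr !mulmxA.
by rewrite key !mulmxA.
Qed.

(* The iterates for the data (A^T, Q, G), whose Riccati equation is the one
   solved by Y, are the swapped iterates for (A, G, Q). *)
Definition adda_swap (K : realType) n (s : adda_state K n) : adda_state K n :=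
  AddaState (adda_A s)^T (adda_Y s) (adda_X s).

(** The invariant of the iteration: at step [k], [M] is the Cayley transform to the power [2 ^ k].
    Semi-definiteness is carried along because it makes the matrices inverted by the next step
    nonsingular. *)
Definition adda_linked (K : realType) n (X M : 'M[K]_n) (s : adda_state K n) :=
  [/\ sym_psd (adda_X s), sym_psd (adda_Y s),
      adda_A s = (1%:M + adda_Y s *m X) *m M
    & X - adda_X s = (adda_A s)^T *m X *m M].

Section Step.
Variables (K : realType) (n : nat).
Implicit Types (s : adda_state K n) (X M : 'M[K]_n).

Lemma adda_step_swap s : sym_psd (adda_X s) -> sym_psd (adda_Y s) ->
  adda_step (adda_swap s) = adda_swap (adda_step s).
Proof.
case: s => E P T /= psdP psdT; have [[sP _] [sT _]] := (psdP, psdT).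
rewrite /adda_swap /=; congr AddaState.
- by rewrite !trmx_mul trmx_inv trmx_1DM sP sT mulmxA.
- by rewrite trmxK -[E *m _ *m T]mulmxA invmx_1DM_mul// mulmxA.
- by rewrite trmxK -[E^T *m _ *m P]mulmxA invmx_1DM_mul// mulmxA.
Qed.

(** The increment of [X] is a congruence of [P (1 + T P)^-1]. The claim for [Y] is the one for [X]
    on the swapped state. *)
Lemma adda_step_psd s : sym_psd (adda_X s) -> sym_psd (adda_Y s) ->
  sym_psd (adda_X (adda_step s)) /\ sym_psd (adda_Y (adda_step s)).
Proof.
have stepX t : sym_psd (adda_X t) -> sym_psd (adda_Y t) ->
    sym_psd (adda_X (adda_step t)).
  case: t => E P T /= psdP psdT; apply: psdD => //.
  by rewrite -[E^T *m _ *m P]mulmxA invmx_1DM_mul//; exact/psd_congr/psd_invmx_1DM.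
move=> psdX psdY; split; first exact: stepX.
have -> : adda_Y (adda_step s) = adda_X (adda_step (adda_swap s)).
  by rewrite adda_step_swap.
exact: stepX.
Qed.

Lemma adda_linked_step s X M :
  adda_linked X M s -> adda_linked X (M *m M) (adda_step s).
Proof.
move=> [psdP psdT EE XP]; have [psdP' psdT'] := adda_step_psd psdP psdT.
have [EE' XP'] := doubling_step psdP psdT EE XP.
by split=> //; case: s {psdP psdT EE XP psdP' psdT'} EE' XP'.
Qed.

End Step.

(** * Initial iterates and the Cayley transform *)

Lemma trmx_sub_scalar (R : pzRingType) n (T : 'M[R]_n) a :
  T^T - a%:M = (T - a%:M)^T.
Proof. by rewrite [RHS]linearB/= tr_scalar_mx. Qed.

Section Init.
Variables (K : realType) (n : nat) (A G Q : 'M[K]_n) (alpha : K).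
Hypotheses (psdG : sym_psd G) (psdQ : sym_psd Q).
Hypotheses (alpha_gt0 : 0 < alpha) (unitA : A - alpha%:M \in unitmx).

Let Aa := A - alpha%:M.
Let U := Aa^T + Q *m invmx Aa *m G.
Let V := Aa + G *m (invmx Aa)^T *m Q.
(** The factorisation [U = Aa^T (1 + Qt G)] reduces [U] and the initial [X] to the semi-definite
    pair [(Qt, G)]. *)
Let Qt := (invmx Aa)^T *m Q *m invmx Aa.

Let psdQt : sym_psd Qt. Proof. exact: psd_congr. Qed.

Let UE : U = Aa^T *m (1%:M + Qt *m G).
Proof.
by rewrite mulmxDr mulmx1 /Qt !mulmxA -trmx_mul mulVmx// trmx1 mul1mx.
Qed.

Lemma adda_init_unit : U \in unitmx.
Proof. by rewrite UE unitmx_mul unitmx_tr unitA psd_1DM_unit. Qed.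

(** Up to the factor [2 * alpha], the initial [X] is [Qt (1 + G Qt)^-1]. *)
Lemma adda_init_psd : sym_psd (adda_X (adda_init A G Q alpha)).
Proof.
apply: psdZ; first by rewrite mulr_ge0// ltW.
suff -> : invmx U *m Q *m invmx Aa = Qt *m invmx (1%:M + G *m Qt).
  exact: psd_invmx_1DM.
rewrite -invmx_1DM_mul//; apply: (can_inj (mulKmx adda_init_unit)).
rewrite -mulmxA mulKVmx ?adda_init_unit// UE -mulmxA mulKVmx ?psd_1DM_unit//.
by rewrite /Qt !mulmxA -trmx_mul mulVmx// trmx1 mul1mx.
Qed.

(** Passing to the transposed data exchanges the roles of [U] and [V]. *)
Lemma adda_init_trE :
  adda_init A^T Q G alpha =
  {| adda_A := 1%:M + (2 * alpha) *: invmx U;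
     adda_X := (2 * alpha) *: (invmx V *m G *m (invmx Aa)^T);
     adda_Y := (2 * alpha) *: ((invmx Aa)^T *m Q *m invmx V) |}.
Proof.
by rewrite /adda_init trmx_sub_scalar trmxK -!trmx_inv trmxK.
Qed.

End Init.

Section InitLinked.
Variables (K : realType) (n : nat) (A G Q : 'M[K]_n) (alpha : K).
Hypotheses (psdG : sym_psd G) (psdQ : sym_psd Q).
Hypotheses (alpha_gt0 : 0 < alpha) (unitA : A - alpha%:M \in unitmx).

Let unitAt : A^T - alpha%:M \in unitmx.
Proof. by rewrite trmx_sub_scalar unitmx_tr. Qed.

(** Since [V^T = U], the initial [X] of one problem is the transpose of the initial [Y] of the
    other; the transpose disappears because [adda_init_psd] makes both initial [X] symmetric. *)
Lemma adda_init_swap :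
  adda_init A^T Q G alpha = adda_swap (adda_init A G Q alpha).
Proof.
have [[sG _] [sQ _]] := (psdG, psdQ).
have [sX0 _] := adda_init_psd psdG psdQ alpha_gt0 unitA.
have [sX0' _] := adda_init_psd psdQ psdG alpha_gt0 unitAt.
rewrite adda_init_trE /= in sX0' *; rewrite /= in sX0.
rewrite /adda_init /adda_swap /=; congr AddaState.
- rewrite [RHS]linearD [in RHS]linearZ/= trmx1 trmx_inv.
  by rewrite [(_ + G *m _ *m _)^T]linearD/= !trmx_mul trmxK sG sQ mulmxA.
- rewrite -sX0' [LHS]linearZ/= !trmx_mul trmxK sG trmx_inv.
  by rewrite [(_ + G *m _ *m _)^T]linearD/= !trmx_mul trmxK sG sQ !mulmxA.
- rewrite -sX0 [RHS]linearZ/= !trmx_mul sQ.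
  rewrite [(invmx (_ + Q *m _ *m _))^T]trmx_inv.
  by rewrite [(_ + Q *m _ *m _)^T]linearD/= !trmx_mul trmxK sG sQ !mulmxA.
Qed.

End InitLinked.

Lemma cayleyE (K : realType) n (T : 'M[K]_n) alpha :
  T - alpha%:M \in unitmx ->
  cayley T alpha = 1%:M + (2 * alpha) *: invmx (T - alpha%:M).
Proof.
move=> uT; apply: (can_inj (mulmxK uT)); rewrite /cayley mulmxKV//.
rewrite mulmxDl mul1mx -scalemxAl mulVmx// scalemx1 mulr2n mulrDl !mul1r.
by rewrite raddfD/= addrA subrK.
Qed.

Section Linked.
Variables (K : realType) (n : nat) (A G Q X : 'M[K]_n) (alpha : K).
Hypotheses (psdG : sym_psd G) (psdQ : sym_psd Q).
Hypotheses (alpha_gt0 : 0 < alpha) (unitA : A - alpha%:M \in unitmx).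
Hypothesis care : A^T *m X + X *m A + Q - X *m G *m X = 0.
Hypothesis unitR : A - G *m X - alpha%:M \in unitmx.

Let a := A - alpha%:M.
Let b := (invmx a)^T.
Let U := a^T + Q *m invmx a *m G.
Let V := a + G *m b *m Q.
Let r := A - G *m X - alpha%:M.
Let c := 2 * alpha.

Let rE : r = a - G *m X. Proof. by rewrite /r /a addrAC. Qed.

Let unitU : U \in unitmx. Proof. exact: adda_init_unit. Qed.

Let unitV : V \in unitmx.
Proof.
have [[sG _] [sQ _]] := (psdG, psdQ).
rewrite -unitmx_tr; suff -> : V^T = U by [].
by rewrite [LHS]linearD/= !trmx_mul trmxK sG sQ mulmxA.
Qed.

(** The second block row of [H [I; X] = [I; X] R], shifted by [alpha]; here [r + c%:M] is
    [R + alpha]. *)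
Let care_shift : X *m (r + c%:M) = - (a^T *m X) - Q.
Proof.
have -> : r + c%:M = A - G *m X + alpha%:M.
  by rewrite /r /c mulr2n mulrDl !mul1r raddfD/= addrA subrK.
rewrite /a -trmx_sub_scalar mulmxDr mulmxBr mulmxBl opprB mul_scalar_mx mul_mx_scalar.
rewrite mulmxA; apply/eqP; rewrite -subr_eq0 -care; apply/eqP.
move: (X *m A) (A^T *m X) (X *m G *m X) => XA AX XGX.
by apply/matrixP => i j; rewrite !mxE; ring.
Qed.

(** Multiplied by [invmx V], this becomes the relation for the initial [Ah]; [primal_shift] below,
    multiplied by [invmx U], becomes the one for [X - X_0]. *)
Let dual_shift : V + G *m b *m (X *m (r + c%:M)) = r.
Proof.
have ba : b *m a^T = 1%:M by rewrite -trmx_mul mulmxV// trmx1.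
rewrite care_shift mulmxBr mulmxN mulmxA -(mulmxA G) ba mulmx1 rE.
by rewrite addrA addrAC /V addrK.
Qed.

Let primal_shift : Q *m invmx a *m r = - (U *m X) - X *m (r + c%:M).
Proof.
rewrite care_shift /U mulmxDl opprD opprB opprK rE mulmxBr mulmxKV//.
rewrite mulmxA; move: (a^T *m X) (_ *m X) => aX QX.
by apply/matrixP => i j; rewrite !mxE; ring.
Qed.

Lemma adda_init_linked :
  adda_linked X (cayley (A - G *m X) alpha) (adda_init A G Q alpha).
Proof.
have unitAt : A^T - alpha%:M \in unitmx by rewrite trmx_sub_scalar unitmx_tr.
have swapE := adda_init_swap psdG psdQ alpha_gt0 unitA.
have psdX0 := adda_init_psd psdG psdQ alpha_gt0 unitA.
have psdY0 := adda_init_psd psdQ psdG alpha_gt0 unitAt.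
have Y0E : adda_Y (adda_init A G Q alpha) = c *: (invmx V *m (G *m b)).
  by rewrite -[LHS]/(adda_X (adda_swap _)) -swapE adda_init_trE mulmxA.
have AtE : (adda_A (adda_init A G Q alpha))^T = 1%:M + c *: invmx U.
  by rewrite -[LHS]/(adda_A (adda_swap _)) -swapE adda_init_trE.
(* Both relations are checked after right multiplication by [r], which turns the Cayley transform
   into [r + c%:M]. *)
have cr : (1%:M + c *: invmx r) *m r = r + c%:M.
  by rewrite mulmxDl mul1mx -scalemxAl mulVmx// scalemx1.
rewrite /adda_linked AtE cayleyE// -/r -/c; split=> //.
- by move: psdY0; rewrite swapE.
- apply: (can_inj (mulmxK unitR)); rewrite -/r -mulmxA cr Y0E /= -/a -/b -/V -/c.
  have GbX : G *m b *m X *m (r + c%:M) = r - V.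
    by rewrite -mulmxA -{2}dual_shift [X in _ = X - _]addrC addrK.
  rewrite !mulmxDl !mul1mx -!scalemxAl -(mulmxA (invmx V)) -(mulmxA (invmx V)).
  rewrite GbX [invmx V *m (r - V)]mulmxBr mulVmx// [c *: (_ - _)]scalerBr.
  by rewrite scalemx1 addrACA subrr addr0.
- apply: (can_inj (mulmxK unitR)); rewrite -/r -[RHS]mulmxA cr /= -/a -/U -/c.
  have QX : invmx U *m Q *m invmx a *m r = - X - invmx U *m (X *m (r + c%:M)).
    rewrite -2!mulmxA (mulmxA Q) primal_shift mulmxDr !mulmxN.
    by rewrite mulKmx.
  have XrE : X *m r = X *m (r + c%:M) - c *: X.
    by rewrite [X *m (r + _)]mulmxDr mul_mx_scalar addrK.
  rewrite mulmxBl -scalemxAl QX XrE -[_ *m X *m _]mulmxA mulmxDl mul1mx -scalemxAl.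
  by rewrite [c *: (_ - _)]scalerBr scalerN opprB opprK addrACA addNr addr0.
Qed.

End Linked.

Lemma adda_psd (K : realType) n (A G Q : 'M[K]_n) alpha k :
  sym_psd G -> sym_psd Q -> 0 < alpha -> A - alpha%:M \in unitmx ->
  sym_psd (adda_X (adda A G Q alpha k)) /\ sym_psd (adda_Y (adda A G Q alpha k)).
Proof.
move=> psdG psdQ alpha_gt0 unitA; elim: k => [|k [psdX psdY]].
  split; first exact: adda_init_psd.
  have -> : adda_Y (adda A G Q alpha 0) = adda_X (adda_init A^T Q G alpha).
    by rewrite adda_init_swap.
  by apply: adda_init_psd => //; rewrite trmx_sub_scalar unitmx_tr.
exact: (@adda_step_psd _ _ (adda A G Q alpha k)).
Qed.

Lemma adda_linked_iter (K : realType) n (A G Q X : 'M[K]_n) alpha k :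
  sym_psd G -> sym_psd Q -> 0 < alpha -> A - alpha%:M \in unitmx ->
  A^T *m X + X *m A + Q - X *m G *m X = 0 ->
  A - G *m X - alpha%:M \in unitmx ->
  adda_linked X (cayley (A - G *m X) alpha ^+ (2 ^ k)%N) (adda A G Q alpha k).
Proof.
move=> psdG psdQ alpha_gt0 unitA care unitR; elim: k => [|k IHk].
  by rewrite expr1; exact: adda_init_linked.
by rewrite expnS mul2n -addnn exprD; exact: adda_linked_step.
Qed.

Lemma adda_trE (K : realType) n (A G Q : 'M[K]_n) alpha k :
  sym_psd G -> sym_psd Q -> 0 < alpha -> A - alpha%:M \in unitmx ->
  adda A^T Q G alpha k = adda_swap (adda A G Q alpha k).
Proof.
move=> psdG psdQ alpha_gt0 unitA; elim: k => [|k IHk].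
  exact: adda_init_swap.
have [psdX psdY] := adda_psd k psdG psdQ alpha_gt0 unitA.
by rewrite -[LHS]/(adda_step (adda _ _ _ _ k)) IHk adda_step_swap.
Qed.

(** * Norm bounds from the invariant *)

Section LinkedBounds.
Variables (K : realType) (n : nat).
Implicit Types (X Y M N : 'M[K]_n) (s : adda_state K n).

Lemma adda_linked_gap_psd X M s :
  sym_psd X -> adda_linked X M s -> sym_psd (X - adda_X s).
Proof.
move=> psdX [_ psdY EE ->]; rewrite EE trmx_mul trmx_1DM.
have [[sX _] [sT _]] := (psdX, psdY).
rewrite sX sT -(mulmxA M^T).
have -> : (1%:M + X *m adda_Y s) *m X = X + X^T *m adda_Y s *m X.
  by rewrite sX mulmxDl mul1mx.
by apply/psd_congr/psdD => //; exact: psd_congr.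
Qed.

Lemma adda_linked_X_le X M s :
  sym_psd X -> adda_linked X M s -> mxnorm2 (adda_X s) <= mxnorm2 X.
Proof.
move=> psdX Hs; apply: psd_mxnorm2_le; last exact: adda_linked_gap_psd Hs.
by case: Hs.
Qed.

Lemma mxnorm2_1DM (P T : 'M[K]_n) p t :
  mxnorm2 P <= p -> mxnorm2 T <= t -> mxnorm2 (1%:M + P *m T) <= 1 + p * t.
Proof.
move=> Pp Tt; apply: le_trans (mxnorm2D _ _) _; apply: lerD.
  exact: mxnorm2_1_le.
by apply: le_trans (mxnorm2M _ _) _; apply: ler_pM => //; exact: mxnorm2_ge0.
Qed.

(** The swapped link serves to bound the norm of [adda_Y s] by that of [Y]. *)
Lemma adda_linked_A_le X Y M N s : sym_psd Y ->
  adda_linked X M s -> adda_linked Y N (adda_swap s) ->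
  mxnorm2 (adda_A s) <= (1 + mxnorm2 Y * mxnorm2 X) * mxnorm2 M.
Proof.
move=> psdY [_ _ -> _] /(adda_linked_X_le psdY)/= TY.
apply: le_trans (mxnorm2M _ _) _; rewrite ler_wpM2r ?mxnorm2_ge0//.
exact: mxnorm2_1DM.
Qed.

(** In [X - X_k = Ah_k^T X M], the swapped link rewrites [Ah_k^T] as [(1 + X_k Y) N], which brings
    in the second small factor. *)
Lemma adda_linked_gap_le X Y M N s : sym_psd X ->
  adda_linked X M s -> adda_linked Y N (adda_swap s) ->
  mxnorm2 (X - adda_X s)
    <= (mxnorm2 X + mxnorm2 X ^+ 2 * mxnorm2 Y) * mxnorm2 N * mxnorm2 M.
Proof.
move=> psdX Hs [_ _ /= EN _]; have PX := adda_linked_X_le psdX Hs.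
case: Hs => _ _ _ ->; rewrite EN.
apply: le_trans (mxnorm2M _ _) _; rewrite ler_wpM2r ?mxnorm2_ge0//.
apply: le_trans (mxnorm2M _ _) _.
have -> : (mxnorm2 X + mxnorm2 X ^+ 2 * mxnorm2 Y) * mxnorm2 N
    = (1 + mxnorm2 X * mxnorm2 Y) * mxnorm2 N * mxnorm2 X by ring.
rewrite ler_wpM2r ?mxnorm2_ge0//.
apply: le_trans (mxnorm2M _ _) _; rewrite ler_wpM2r ?mxnorm2_ge0//.
exact: mxnorm2_1DM.
Qed.

End LinkedBounds.

(** * Powers of a matrix of spectral radius less than one *)

Lemma cvg0_linear_recurrence (R : realType) (c : R) (u e : R^nat) :
  0 <= c < 1 -> (forall j, 0 <= u j) -> (forall j, u j.+1 <= c * u j + e j) ->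
  e @ \oo --> 0 -> u @ \oo --> 0.
Proof.
move=> /andP[c0 c1] u0 ule e_to0; apply/cvgrPdist_lt => eps eps0.
(* The threshold for [e] that makes [eps / 2] the fixed point of the affine recurrence of ratio
   [c]. *)
have d0 : 0 < (1 - c) * (eps / 2) by rewrite mulr_gt0 ?subr_gt0 ?divr_gt0.
have /cvgrPdist_lt/(_ _ d0)[N _ eN] := e_to0.
have uN j : u (N + j)%N <= c ^+ j * u N + eps / 2.
  elim: j => [|j IHj]; first by rewrite addn0 expr0 mul1r lerDl divr_ge0// ltW.
  rewrite addnS (le_trans (ule _))//.
  have := eN (N + j)%N; rewrite /= leq_addr sub0r normrN => /(_ isT)/ltW.
  move=> /(le_trans (ler_norm _)) ej.
  by have := ler_wpM2l c0 IHj; rewrite exprS; lra.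
have c_norm : `|c| < 1 by rewrite ger0_norm.
have cu : c ^+ j * u N @[j --> \oo] --> (0 : R).
  by rewrite -[X in _ --> X](mul0r (u N)); apply: cvgMl; exact: cvg_expr.
have eps20 : 0 < eps / 2 by rewrite divr_gt0.
have /cvgrPdist_lt/(_ _ eps20)[N' _ eN'] := cu.
exists (N + N')%N => // j /= Nj; rewrite sub0r normrN ger0_norm//.
have jE : j = (N + (j - N))%N by rewrite subnKC// (leq_trans _ Nj)// leq_addr.
have := eN' (j - N)%N; rewrite /= sub0r normrN => /(_ _).
have -> : (N' <= j - N)%N by rewrite leq_subRL ?(leq_trans _ Nj)// leq_addr.
move=> /(_ isT) /(le_lt_trans (ler_norm _)) lt2.
by rewrite jE (le_lt_trans (uN _))//; lra.
Qed.

(* Induction on the number of linear factors: with [w := (M - z) *m V], each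
   entry of [M ^+ j *m V] satisfies a recurrence of ratio [z] driven by the
   same entry of [M ^+ j *m w]. *)
Lemma powers_to0_of_annihilator (R : realType) n p (M : 'M[R[i]%C]_n.+1)
    (s : seq R[i]%C) (V : 'M[R[i]%C]_(n.+1, p)) :
  (forall z, z \in s -> ComplexField.Normc.normc z < 1) ->
  horner_mx M (\prod_(z <- s) ('X - z%:P)) *m V = 0 ->
  forall i l, ComplexField.Normc.normc ((M ^+ j *m V) i l) @[j --> \oo] --> (0 : R).
Proof.
elim: s V => [|z s IHs] V s1 MV i l.
  move: MV; rewrite big_nil rmorph1 mul1mx => ->.
  under eq_fun do rewrite mulmx0 mxE ComplexField.Normc.normc0.
  exact: cvg_cst.
pose w := (M - z%:M) *m V.
apply: (@cvg0_linear_recurrence _ (ComplexField.Normc.normc z) _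
  (fun j => ComplexField.Normc.normc ((M ^+ j *m w) i l))).
- by rewrite s1 ?mem_head// andbT; case: (z) => a b; exact: sqrtr_ge0.
- by move=> j; case: (_ i l) => a b; exact: sqrtr_ge0.
- move=> j; rewrite -ComplexField.Normc.normcM.
  have -> : (M ^+ j.+1 *m V) i l = z * (M ^+ j *m V) i l + (M ^+ j *m w) i l.
    rewrite /w mulmxBl mul_scalar_mx mulmxBr -scalemxAr exprSr -mulmxA.
    by rewrite [RHS]addrC !mxE subrK.
  exact: le_normcD.
- apply: IHs => [y ys|]; first by rewrite s1// inE ys orbT.
  rewrite /w mulmxA; move: MV; rewrite big_cons mulrC rmorphM/=.
  by rewrite rmorphB/= horner_mx_X horner_mx_C.
Qed.

Lemma normc_real (R : rcfType) (x : R) : ComplexField.Normc.normc x%:C%C = `|x|.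
Proof. by rewrite /= expr0n addr0 sqrtr_sqr. Qed.

(** Over the complex numbers the characteristic polynomial splits into linear factors with roots of
    modulus less than one, and by Cayley-Hamilton it annihilates the matrix; no Jordan form is
    involved. *)
Lemma spectral_radius_powers_to0 (R : realType) n (M : 'M[R]_n) :
  spectral_radius M < 1 ->
  forall i l, (M ^+ j) i l @[j --> \oo] --> (0 : R).
Proof.
case: n M => [M _ []//|n M rho1 i l].
pose Mc := map_mx (real_complex R) M.
have [s sE] := closed_field_poly_normal (char_poly Mc).
rewrite (monicP (char_poly_monic _)) scale1r in sE.
have s1 z : z \in s -> ComplexField.Normc.normc z < 1.
  move=> zs; apply: le_lt_trans rho1; apply: ub_le_sup; last first.
    by exists z => //=; rewrite eigenvalue_root_char sE root_prod_XsubC.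
  (* An upper bound on the moduli of the eigenvalues, so that the supremum dominates each of
     them. *)
  exists (\sum_(y <- s) ComplexField.Normc.normc y) => _ [y /= + <-].
  rewrite eigenvalue_root_char sE root_prod_XsubC => ys.
  rewrite (big_rem y)//= lerDl sumr_ge0// => -[a b] _; exact: sqrtr_ge0.
have := @powers_to0_of_annihilator _ _ _ Mc s 1%:M s1 _ i l.
rewrite mulmx1 -sE Cayley_Hamilton => /(_ erefl).
under eq_fun do rewrite mulmx1 -rmorphXn/= mxE normc_real.
by move=> /norm_cvg0.
Qed.

Lemma cvg_sum_ord (R : realType) k (f : 'I_k -> R^nat) (l : 'I_k -> R) :
  (forall i, f i @ \oo --> l i) ->
  \sum_(i < k) f i j @[j --> \oo] --> \sum_(i < k) l i.
Proof.
elim: k f l => [|k IHk] f l fl.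
  by rewrite big_ord0; under eq_fun do rewrite big_ord0; exact: cvg_cst.
rewrite big_ord_recr/=; under eq_fun do rewrite big_ord_recr/=.
by apply: cvgD => //; apply: IHk => i; exact: fl.
Qed.

Lemma mxnorm2_to0 (R : realType) m n (M : nat -> 'M[R]_(m, n)) :
  (forall i l, M j i l @[j --> \oo] --> (0 : R)) ->
  mxnorm2 (M j) @[j --> \oo] --> (0 : R).
Proof.
move=> M0; apply: (squeeze_cvgr _ (cvg_cst 0)).
  by near=> j; apply/andP; split; [exact: mxnorm2_ge0|exact: mxnorm2_le_sum].
rewrite [X in _ --> X](_ : _ = \sum_(i < m) \sum_(l < n) `|0 : R|); last first.
  by rewrite big1// => i _; rewrite big1// => l _; rewrite normr0.
apply: (@cvg_sum_ord _ _ (fun i j => \sum_(l < n) `|M j i l|)) => i.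
by apply: (@cvg_sum_ord _ _ (fun l j => `|M j i l|)) => l; exact: cvg_norm.
Unshelve. all: by end_near. Qed.

Lemma cvg_pow2 : (2 ^ k)%N @[k --> \oo] --> \oo.
Proof.
move=> P [N _ NP]; exists N => // k /= Nk; apply: NP => /=.
exact: leq_trans Nk (ltnW (ltn_expl _ _)).
Qed.

(** * The dual closed-loop matrix *)

(** The difference of the two sides is [X] times the residual of the equation for [Y], minus the
    residual of the equation for [X] times [Y]. *)
Lemma riccati_closed_loop_similar (K : realType) n (A G Q X Y : 'M[K]_n) :
  X^T = X -> G^T = G ->
  A^T *m X + X *m A + Q - X *m G *m X = 0 ->
  A *m Y + Y *m A^T - Y *m Q *m Y + G = 0 ->
  (1%:M + X *m Y) *m (A^T - Q *m Y) = (A - G *m X)^T *m (1%:M + X *m Y).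
Proof.
move=> sX sG careX careY.
have -> : (A - G *m X)^T = A^T - X *m G by rewrite [LHS]linearB/= trmx_mul sX sG.
apply/eqP; rewrite -subr_eq0.
suff -> : (1%:M + X *m Y) *m (A^T - Q *m Y) - (A^T - X *m G) *m (1%:M + X *m Y)
  = X *m (A *m Y + Y *m A^T - Y *m Q *m Y + G)
    - (A^T *m X + X *m A + Q - X *m G *m X) *m Y.
  by rewrite careX careY mulmx0 mul0mx subrr.
rewrite !(mulmxDl, mulmxDr, mulmxN, mulNmx) !mul1mx !mulmx1 !mulmxA.
move: (A^T *m X *m Y) (X *m A *m Y) (Q *m Y) (X *m G *m X *m Y) (X *m Y *m A^T).
move: (X *m Y *m Q *m Y) (X *m G) => t1 t2 t3 t4 t5 t6 t7.
by apply/matrixP => i j; rewrite !mxE; ring.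
Qed.

(** An intertwining of [S] and [T] passes to their shifted inverses, and [cayleyE] writes the
    transform as an affine function of such an inverse. *)
Lemma cayley_intertwine (K : realType) n (W S T : 'M[K]_n) alpha :
  S - alpha%:M \in unitmx -> T - alpha%:M \in unitmx ->
  W *m S = T *m W -> W *m cayley S alpha = cayley T alpha *m W.
Proof.
move=> uS uT WST; rewrite !cayleyE// mulmxDl mulmxDr mul1mx mulmx1.
rewrite -scalemxAr -scalemxAl; congr (_ + _ *: _).
apply: (can_inj (mulmxK uS)); rewrite mulmxKV// -mulmxA mulmxBr WST.
have -> : T *m W - W *m alpha%:M = (T - alpha%:M) *m W.
  by rewrite mulmxBl mul_scalar_mx mul_mx_scalar.
by rewrite mulKmx.
Qed.

Lemma trmx_cayley (K : realType) n (T : 'M[K]_n) alpha :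
  T - alpha%:M \in unitmx -> (cayley T alpha)^T = cayley T^T alpha.
Proof.
move=> uT; rewrite !cayleyE ?trmx_sub_scalar ?unitmx_tr//.
by rewrite [LHS]linearD [in LHS]linearZ/= trmx1 trmx_inv.
Qed.

Lemma intertwine_exp (K : realType) n (W S T : 'M[K]_n) j :
  W *m S = T *m W -> W *m S ^+ j = T ^+ j *m W.
Proof.
move=> WST; elim: j => [|j IHj]; first by rewrite !expr0 mulmx1 mul1mx.
by rewrite !exprSr [LHS]mulmxA IHj -mulmxA WST mulmxA.
Qed.

Lemma trmx_exp (R : comPzRingType) n (T : 'M[R]_n) j : (T ^+ j)^T = T^T ^+ j.
Proof.
elim: j => [|j IHj]; first by rewrite !expr0 trmx1.
by rewrite exprS exprSr trmx_mul IHj.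
Qed.

(** The decay is inherited from [R]: conjugation by [W = 1 + X Y], nonsingular by semi-definiteness,
    costs only the constant factor [|W^-1| |W|]. *)
Lemma dual_closed_loop_powers_to0 (K : realType) n (A G Q X Y : 'M[K]_n) alpha :
  sym_psd X -> sym_psd Y -> G^T = G ->
  A^T *m X + X *m A + Q - X *m G *m X = 0 ->
  A *m Y + Y *m A^T - Y *m Q *m Y + G = 0 ->
  A - G *m X - alpha%:M \in unitmx -> A^T - Q *m Y - alpha%:M \in unitmx ->
  (forall i l, (cayley (A - G *m X) alpha ^+ j) i l @[j --> \oo] --> (0 : K)) ->
  mxnorm2 (cayley (A^T - Q *m Y) alpha ^+ j) @[j --> \oo] --> (0 : K).
Proof.
move=> psdX psdY sG careX careY unitR unitS R0.
have [sX _] := psdX; set R := A - G *m X in unitR R0 *.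
set S := A^T - Q *m Y in unitS *; set W := 1%:M + X *m Y.
have unitW : W \in unitmx by exact: psd_1DM_unit.
have unitRt : R^T - alpha%:M \in unitmx by rewrite trmx_sub_scalar unitmx_tr.
have WS : W *m S = R^T *m W by exact: riccati_closed_loop_similar.
have WC := cayley_intertwine unitS unitRt WS.
have powE j : cayley S alpha ^+ j = invmx W *m (cayley R alpha ^+ j)^T *m W.
  apply: (can_inj (mulKmx unitW)); rewrite (intertwine_exp _ WC).
  by rewrite -mulmxA mulKVmx// -trmx_cayley// trmx_exp.
under eq_fun do rewrite powE.
have Rt0 : mxnorm2 (cayley R alpha ^+ j)^T @[j --> \oo] --> (0 : K).
  apply: (@mxnorm2_to0 _ _ _ (fun j => (cayley R alpha ^+ j)^T)) => i l.
  by under eq_fun do rewrite mxE; exact: R0.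
apply: (squeeze_cvgr (h := fun j =>
  mxnorm2 (invmx W) * mxnorm2 (cayley R alpha ^+ j)^T * mxnorm2 W) _ (cvg_cst 0)).
  near=> j; rewrite mxnorm2_ge0/= (le_trans (mxnorm2M _ _))//.
  by rewrite ler_wpM2r ?mxnorm2_ge0 ?mxnorm2M.
rewrite -[X in _ --> X](mul0r (mxnorm2 W)); apply: cvgMl.
by rewrite -[X in _ --> X](mulr0 (mxnorm2 (invmx W))); exact: cvgMr.
Unshelve. all: by end_near. Qed.

(** * Convergence bounds for the three sequences *)

Theorem corollary1 (K : realType) (n m p : nat)
    (A : 'M[K]_n) (B : 'M[K]_(n, m)) (C : 'M[K]_(p, n))
    (X Y : 'M[K]_n) (alpha : K) :
  let G := B *m B^T in
  let Q := C^T *m C in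
  let R := A - G *m X in
  let S := A^T - Q *m Y in
  let Ah := fun k : nat => adda_A (adda A G Q alpha k) in
  let Xk := fun k : nat => adda_X (adda A G Q alpha k) in
  let Yk := fun k : nat => adda_Y (adda A G Q alpha k) in
  let boundA := fun k : nat =>
    (1 + mxnorm2 Y * mxnorm2 X) * mxnorm2 (cayley R alpha ^+ (2 ^ k)%N) in
  let boundX := fun k : nat =>
    (mxnorm2 X + mxnorm2 X ^+ 2 * mxnorm2 Y)
      * mxnorm2 (cayley S alpha ^+ (2 ^ k)%N)
      * mxnorm2 (cayley R alpha ^+ (2 ^ k)%N) in
  let boundY := fun k : nat =>
    (mxnorm2 Y + mxnorm2 Y ^+ 2 * mxnorm2 X)
      * mxnorm2 (cayley R alpha ^+ (2 ^ k)%N)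
      * mxnorm2 (cayley S alpha ^+ (2 ^ k)%N) in
  sym_psd X ->
  sym_psd Y ->
  A^T *m X + X *m A + Q - X *m G *m X = 0 ->
  A *m Y + Y *m A^T - Y *m Q *m Y + G = 0 ->
  0 < alpha ->
  A - alpha%:M \in unitmx ->
  R - alpha%:M \in unitmx ->
  S - alpha%:M \in unitmx ->
  spectral_radius (cayley R alpha) < 1 ->
  [/\ (forall k : nat, mxnorm2 (Ah k) <= boundA k)
        /\ boundA k @[k --> \oo] --> (0 : K),
      (forall k : nat, mxnorm2 (X - Xk k) <= boundX k)
        /\ boundX k @[k --> \oo] --> (0 : K)
    & (forall k : nat, mxnorm2 (Y - Yk k) <= boundY k)
        /\ boundY k @[k --> \oo] --> (0 : K)].
Proof.
move=> G Q R S Ah Xk Yk boundA boundX boundY psdX psdY careX careY alpha_gt0.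
move=> unitA unitR unitS rhoR.
have psdG : sym_psd G by rewrite /G -{1}[B]trmxK; exact: psd_gram.
have psdQ : sym_psd Q by exact: psd_gram.
have [sG _] := psdG.
have unitAt : A^T - alpha%:M \in unitmx by rewrite trmx_sub_scalar unitmx_tr.
have careY' : A^T^T *m Y + Y *m A^T + G - Y *m Q *m Y = 0.
  by rewrite trmxK addrAC.
have linkX k := adda_linked_iter k psdG psdQ alpha_gt0 unitA careX unitR.
have linkY k : adda_linked Y (cayley S alpha ^+ (2 ^ k)%N)
    (adda_swap (adda A G Q alpha k)).
  rewrite -(adda_trE k psdG psdQ alpha_gt0 unitA).
  exact: adda_linked_iter.
(* Swapping twice restores the state, so the bound for [Y] is the bound for [X] applied to the
   swapped state with [X] and [Y] exchanged. *)
have linkX' k : adda_linked X (cayley R alpha ^+ (2 ^ k)%N)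
    (adda_swap (adda_swap (adda A G Q alpha k))).
  by rewrite /adda_swap/= trmxK; case: (adda _ _ _ _ k) (linkX k).
have R0 := spectral_radius_powers_to0 rhoR.
have CR0 : mxnorm2 (cayley R alpha ^+ (2 ^ k)%N) @[k --> \oo] --> (0 : K).
  exact: cvg_comp cvg_pow2 (mxnorm2_to0 R0).
have CS0 : mxnorm2 (cayley S alpha ^+ (2 ^ k)%N) @[k --> \oo] --> (0 : K).
  exact: cvg_comp cvg_pow2 (dual_closed_loop_powers_to0 psdX psdY sG careX careY
    unitR unitS R0).
have scaled0 (c : K) (u : nat -> K) :
    u @ \oo --> (0 : K) -> c * u k @[k --> \oo] --> (0 : K).
  by move=> u0; rewrite -[X in _ --> X](mulr0 c); exact: cvgMr.
have product0 (c : K) (u v : nat -> K) : u @ \oo --> (0 : K) ->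
    v @ \oo --> (0 : K) -> c * u k * v k @[k --> \oo] --> (0 : K).
  move=> u0 v0; rewrite -[X in _ --> X](mulr0 0).
  by apply: cvgM v0; exact: scaled0.
split; split.
- by move=> k; exact: adda_linked_A_le (linkX k) (linkY k).
- exact: scaled0 CR0.
- by move=> k; exact: adda_linked_gap_le (linkX k) (linkY k).
- exact: product0 CS0 CR0.
- by move=> k; exact: adda_linked_gap_le (linkY k) (linkX' k).
- exact: product0 CR0 CS0.
Qed.
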